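(* Let $m=4+12q$ with $q=4d$ for a nonnegative integer $d$. The minimal decomposition of $\mathbb{Z}_2$ for the Fibonacci polynomial $F_m$ is $$\mathbb{Z}_2=\{0\}\sqcup\Bigl(\bigcup_{k=0}^{2^3-1}M_k\Bigr)\sqcup(2\mathbb{Z}_2-\{0\}),$$ where $M_k=(1+4k+2^5\mathbb{Z}_2)\cup(3+4k+2^5\mathbb{Z}_2)$. Here $\{0\}$ is the set of a fixed point, the $M_k$'s are the minimal components, and the set $2\mathbb{Z}_2-\{0\}$ is the attracting basin of the fixed point $0$.
   Context: $\mathbb{Z}_2$ is the ring of 2-adic integers with the 2-adic metric. The Fibonacci polynomials are defined by $F_0(x)=0$, $F_1(x)=1$, $F_m(x)=xF_{m-1}(x)+F_{m-2}(x)$ for $m\ge 2$. For a polynomial $f$ over $\mathbb{Z}_2$, a minimal decomposition of $\mathbb{Z}_2$ for $f$ is a decomposition $\mathbb{Z}_2=\mathcal P\sqcup\mathcal M\sqcup\mathcal B$ (some parts possibly empty) in which: $\mathcal P$ is the finite set consisting of all periodic points of $f$; $\mathcal M=\bigsqcup_i\mathcal M_i$ is the union of all (at most countably many) clopen $f$-invariant sets $\mathcal M_i$ (the minimal components), each a finite union of balls, such that each $f:\mathcal M_i\to\mathcal M_i$ is minimal (every orbit is dense in $\mathcal M_i$); and each point of $\mathcal B$ lies in the attracting basin of a periodic orbit or of a minimal subsystem. A point $x$ lies in the attracting basin of a set $C$ (a periodic orbit or minimal component) if the distance from $f^n(x)$ to $C$ tends to $0$ as $n\to\infty$; when a part $\mathcal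 B$ of a decomposition is said to be the attracting basin of $C$, this means every point of $\mathcal B$ lies in the attracting basin of $C$ (the points of $C$ being listed separately). *)

(* Defs.v *)
From HB Require Import structures.
From mathcomp Require Import all_boot all_order all_algebra.
From mathcomp Require Import all_classical all_reals all_analysis.

Set Implicit Arguments.
Unset Strict Implicit.
Unset Printing Implicit Defensive.

Import Order.TTheory GRing.Theory Num.Theory.
Import numFieldNormedType.Exports.

Local Open Scope classical_set_scope.
Local Open Scope ring_scope.

(* Z_2 as the inverse limit of the rings Z/2^n: [x n] is the representative
   in [0, 2^n) of the residue of [x] modulo 2^n. *)
Record Z2 := MkZ2 {
  res2 :> nat -> int;
  res2_coherent : forall n, res2 n = (res2 n.+1 %% 2 ^+ n)%Z
}.

Lemma Z2_ext (x y : Z2) : (forall n, x n = y n) -> x = y.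
Proof.
case: x y => [u hu] [v hv] /= /funext uv; rewrite -{}uv in hv *.
by congr MkZ2; exact: Prop_irrelevance.
Qed.

Lemma res2_mod (x : Z2) n : (x n %% 2 ^+ n)%Z = x n.
Proof. by rewrite res2_coherent modz_mod. Qed.

Lemma Z2_of_subproof (u : nat -> int) :
  (forall n, (u n.+1 %% 2 ^+ n)%Z = (u n %% 2 ^+ n)%Z) ->
  forall n, (u n %% 2 ^+ n)%Z = ((u n.+1 %% 2 ^+ n.+1)%Z %% 2 ^+ n)%Z.
Proof.
move=> hu n; rewrite -hu {1}(divz_eq (u n.+1) (2 ^+ n.+1)) exprS mulrA.
by rewrite modzMDl.
Qed.

Definition Z2_of (u : nat -> int)
    (hu : forall n, (u n.+1 %% 2 ^+ n)%Z = (u n %% 2 ^+ n)%Z) : Z2 :=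
  MkZ2 (Z2_of_subproof hu).

Lemma Z2_const_subproof (z : int) :
  forall n, ((fun=> z) n.+1 %% 2 ^+ n)%Z = ((fun=> z) n %% 2 ^+ n)%Z.
Proof. by []. Qed.

Lemma Z2_opp_subproof (x : Z2) :
  forall n, ((fun n => - x n) n.+1 %% 2 ^+ n)%Z =
    ((fun n => - x n) n %% 2 ^+ n)%Z.
Proof. by move=> n /=; rewrite -modzNm -res2_coherent. Qed.

Lemma Z2_add_subproof (x y : Z2) :
  forall n, ((fun n => x n + y n) n.+1 %% 2 ^+ n)%Z =
    ((fun n => x n + y n) n %% 2 ^+ n)%Z.
Proof. by move=> n /=; rewrite -modzDm -!res2_coherent. Qed.

Lemma Z2_mul_subproof (x y : Z2) :
  forall n, ((fun n => x n * y n) n.+1 %% 2 ^+ n)%Z =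
    ((fun n => x n * y n) n %% 2 ^+ n)%Z.
Proof. by move=> n /=; rewrite -modzMm -!res2_coherent. Qed.

Definition Z2_const z := Z2_of (Z2_const_subproof z).
Definition Z2_opp x := Z2_of (Z2_opp_subproof x).
Definition Z2_add x y := Z2_of (Z2_add_subproof x y).
Definition Z2_mul x y := Z2_of (Z2_mul_subproof x y).

HB.instance Definition _ := gen_eqMixin Z2.
HB.instance Definition _ := gen_choiceMixin Z2.

Lemma Z2_addA : associative Z2_add.
Proof. by move=> x y z; apply: Z2_ext => n /=; rewrite modzDmr modzDml addrA. Qed.

Lemma Z2_addC : commutative Z2_add.
Proof. by move=> x y; apply: Z2_ext => n /=; rewrite addrC. Qed.

Lemma Z2_add0 : left_id (Z2_const 0) Z2_add.
Proof. by move=> x; apply: Z2_ext => n /=; rewrite modzDml add0r res2_mod. Qed.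

Lemma Z2_addN : left_inverse (Z2_const 0) Z2_opp Z2_add.
Proof. by move=> x; apply: Z2_ext => n /=; rewrite modzDml addNr. Qed.

HB.instance Definition _ :=
  GRing.isZmodule.Build Z2 Z2_addA Z2_addC Z2_add0 Z2_addN.

Lemma Z2_mulA : associative Z2_mul.
Proof. by move=> x y z; apply: Z2_ext => n /=; rewrite modzMmr modzMml mulrA. Qed.

Lemma Z2_mulC : commutative Z2_mul.
Proof. by move=> x y; apply: Z2_ext => n /=; rewrite mulrC. Qed.

Lemma Z2_mul1 : left_id (Z2_const 1) Z2_mul.
Proof. by move=> x; apply: Z2_ext => n /=; rewrite modzMml mul1r res2_mod. Qed.

Lemma Z2_mulDl : left_distributive Z2_mul Z2_add.
Proof.
by move=> x y z; apply: Z2_ext => n /=; rewrite modzMml modzDm mulrDl.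
Qed.

Lemma Z2_oner_neq0 : Z2_const 1 != 0.
Proof. by apply/eqP => /(congr1 (fun x : Z2 => x 1%N)). Qed.

HB.instance Definition _ := GRing.Zmodule_isComNzRing.Build Z2
  Z2_mulA Z2_mulC Z2_mul1 Z2_mulDl Z2_oner_neq0.

Lemma res2_0 n : (0 : Z2) n = 0.
Proof. by rewrite /= mod0z. Qed.

Lemma res2D (x y : Z2) n : (x + y) n = ((x n + y n) %% 2 ^+ n)%Z.
Proof. by []. Qed.

Lemma res2N (x : Z2) n : (- x) n = ((- x n) %% 2 ^+ n)%Z.
Proof. by []. Qed.

Lemma res2M (x y : Z2) n : (x * y) n = ((x n * y n) %% 2 ^+ n)%Z.
Proof. by []. Qed.

Lemma res2B_eq0 (x y : Z2) n : ((x - y) n == 0) = (x n == y n).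
Proof.
rewrite res2D res2N modzDmr -[in RHS](res2_mod x) -[in RHS](res2_mod y).
by rewrite eqz_mod_dvd; apply/eqP/dvdz_mod0P.
Qed.

Lemma res2_le (x y : Z2) m n : (m <= n)%N -> x n = y n -> x m = y m.
Proof.
move=> /subnK <-; elim: (n - m)%N => [//|k IH] xy.
by apply: IH; rewrite res2_coherent xy -res2_coherent.
Qed.

Lemma Z2_neq0_ex (x : Z2) : x != 0 -> exists n, x n.+1 != 0.
Proof.
move=> /eqP x0; apply: contrapT => /forallNP h; apply: x0.
apply: Z2_ext => n; rewrite res2_0 res2_coherent.
by have /negP := h n; rewrite negbK => /eqP ->; rewrite mod0z.
Qed.

(* 2-adic valuation (with the junk value 0 at 0): the least n such that
   x is nonzero modulo 2^(n+1). *)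
Definition Z2_val (x : Z2) : nat :=
  if pselect (x != 0) is left h then ex_minn (Z2_neq0_ex h) else 0%N.

Definition Z2_norm (R : realType) (x : Z2) : R :=
  if x == 0 then 0 else 2 ^- Z2_val x.

Lemma Z2_valP (x : Z2) n : x != 0 -> (n <= Z2_val x)%N = (x n == 0).
Proof.
rewrite /Z2_val; case: pselect => // h _; case: ex_minnP => v xv vmin.
apply/idP/eqP => [nv|xn].
  apply: etrans (res2_0 n); apply: (res2_le nv); rewrite res2_0.
  case: v xv vmin {nv} => [|v] _ vmin; first by rewrite res2_coherent expr0 modz1.
  by apply/eqP/negPn/negP => /vmin; rewrite ltnn.
rewrite leqNgt; apply: contraNN xv => vn.
by apply/eqP; rewrite -(res2_0 v.+1); apply: (res2_le vn); rewrite res2_0.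
Qed.

Lemma Z2_norm_le (R : realType) (x : Z2) n :
  (Z2_norm R x <= 2 ^- n) = (x n == 0).
Proof.
rewrite /Z2_norm; have [->|x0] := eqVneq x 0.
  by rewrite res2_0 eqxx invr_ge0 exprn_ge0.
by rewrite lef_pV2 ?posrE ?exprn_gt0// ler_eXn2l ?ltr1n// Z2_valP.
Qed.

Lemma Z2_norm_lt (R : realType) (x : Z2) n :
  (Z2_norm R x < 2 ^- n) = (x n.+1 == 0).
Proof.
rewrite /Z2_norm; have [->|x0] := eqVneq x 0.
  by rewrite res2_0 eqxx invr_gt0 exprn_gt0.
by rewrite ltf_pV2 ?posrE ?exprn_gt0// ltr_eXn2l ?ltr1n// Z2_valP.
Qed.

Lemma Z2_norm_ge0 (R : realType) (x : Z2) : 0 <= Z2_norm R x.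
Proof. by rewrite /Z2_norm; case: ifP => // _; rewrite invr_ge0 exprn_ge0. Qed.

Lemma Z2_norm_eq0 (R : realType) (x : Z2) : Z2_norm R x = 0 -> x = 0.
Proof.
rewrite /Z2_norm; case: eqP => // _ /eqP.
by rewrite invr_eq0 expf_eq0 pnatr_eq0 andbF.
Qed.

Lemma Z2_normN (R : realType) (x : Z2) : Z2_norm R (- x) = Z2_norm R x.
Proof.
have le y : Z2_norm R (- y) <= Z2_norm R y.
  have [->|y0] := eqVneq y 0; first by rewrite oppr0.
  rewrite [leRHS]/Z2_norm (negbTE y0) Z2_norm_le res2N.
  have /eqP -> : y (Z2_val y) == 0 by rewrite -Z2_valP.
  by rewrite oppr0 mod0z.
by apply/eqP; rewrite eq_le le -{1}(opprK x) le.
Qed.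

Lemma Z2_normD (R : realType) (x y : Z2) :
  Z2_norm R (x + y) <= Num.max (Z2_norm R x) (Z2_norm R y).
Proof.
wlog xy : x y / Z2_norm R x <= Z2_norm R y.
  by move=> h; case/orP: (le_total (Z2_norm R x) (Z2_norm R y)) => /h //;
    rewrite addrC maxC.
rewrite (max_idPr xy); have [y0|y0] := eqVneq y 0.
  by rewrite y0 addr0 -y0.
move: xy; rewrite [Z2_norm R y]/Z2_norm (negbTE y0) !Z2_norm_le res2D => /eqP ->.
have /eqP -> : y (Z2_val y) == 0 by rewrite -Z2_valP.
by rewrite addr0 mod0z.
Qed.

Definition Z2_entourage : set_system (Z2 * Z2) :=
  filter_from setT (fun n => [set xy : Z2 * Z2 | xy.1 n = xy.2 n]).

Lemma Z2_entourage_filter : Filter Z2_entourage.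
Proof.
apply: filter_from_filter; first by exists 0%N.
move=> m n _ _; exists (maxn m n) => // -[x y] /= xy.
by split; apply: res2_le xy; rewrite ?leq_maxl ?leq_maxr.
Qed.

Lemma Z2_entourage_diagonal A : Z2_entourage A -> diagonal `<=` A.
Proof.
move=> [n _ nA] [x y] xy; apply: nA.
exact: (congr1 (fun z : Z2 => z n) xy).
Qed.

Lemma Z2_entourage_inv A : Z2_entourage A -> Z2_entourage A^-1%relation.
Proof. by move=> [n _ nA]; exists n => // -[x y] /= xy; apply: nA. Qed.

Lemma Z2_entourage_split A : Z2_entourage A ->
  exists2 B, Z2_entourage B & (B \; B)%relation `<=` A.
Proof.
move=> [n _ nA]; exists [set xy : Z2 * Z2 | xy.1 n = xy.2 n]; first by exists n.
by move=> [x z] [y /= xy yz]; apply: nA; rewrite /= xy.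
Qed.

HB.instance Definition _ := isUniform.Build Z2 Z2_entourage_filter
  Z2_entourage_diagonal Z2_entourage_inv Z2_entourage_split.

Definition Z2_dist (R : realType) (x y : Z2) : R := Z2_norm R (x - y).

Definition Z2_ball (R : realType) (x : Z2) (e : R) : set Z2 :=
  [set y | Z2_dist R x y < e].

Lemma Z2_ball_center (R : realType) (x : Z2) (e : R) : 0 < e -> Z2_ball x e x.
Proof. by rewrite /Z2_ball /Z2_dist /= subrr /Z2_norm eqxx. Qed.

Lemma Z2_ball_sym (R : realType) (x y : Z2) (e : R) :
  Z2_ball x e y -> Z2_ball y e x.
Proof. by rewrite /Z2_ball /Z2_dist /= -opprB Z2_normN. Qed.

Lemma Z2_ball_triangle (R : realType) (x y z : Z2) (e1 e2 : R) :
  Z2_ball x e1 y -> Z2_ball y e2 z -> Z2_ball x (e1 + e2) z.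
Proof.
rewrite /Z2_ball /Z2_dist /= => xy yz.
have -> : x - z = (x - y) + (y - z) by rewrite addrA subrK.
apply: le_lt_trans (Z2_normD _ _ _) _; rewrite gt_max.
have e1_ge0 := le_trans (Z2_norm_ge0 R _) (ltW xy).
have e2_ge0 := le_trans (Z2_norm_ge0 R _) (ltW yz).
by rewrite (lt_le_trans xy) ?lerDl// (lt_le_trans yz) ?lerDr.
Qed.

Lemma Z2_entourageE (R : realType) : entourage = entourage_ (@Z2_ball R).
Proof.
apply/seteqP; split => A.
  move=> [n _ nA]; exists (2 ^- n) => /=; first by rewrite invr_gt0 exprn_gt0.
  move=> [x y] /=; rewrite /Z2_ball /Z2_dist /= => /ltW.
  by rewrite Z2_norm_le res2B_eq0 => /eqP xy; apply: nA.
move=> [e /= e0 eA]; have [n ne] : exists n, 2 ^- n < e.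
  have [n] : exists n, e^-1 < n%:R.
    by exists (Num.truncn e^-1).+1; rewrite truncnS_gt.
  move=> en; exists n; rewrite -[e]invrK ltf_pV2 ?posrE ?exprn_gt0 ?invr_gt0//.
  by rewrite (lt_trans en)// -natrX ltr_nat ltn_expl.
exists n => // -[x y] /= xy; apply: eA; rewrite /Z2_ball /Z2_dist /=.
by apply: le_lt_trans ne; rewrite Z2_norm_le res2B_eq0 xy.
Qed.

HB.instance Definition _ (R : realType) := @Uniform_isPseudoMetric.Build R Z2
  (@Z2_ball R) (@Z2_ball_center R) (@Z2_ball_sym R) (@Z2_ball_triangle R)
  (Z2_entourageE R).

Lemma Z2_dist_ge0 (R : realType) (x y : Z2) : 0 <= Z2_dist R x y.
Proof. exact: Z2_norm_ge0. Qed.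

Lemma Z2_dist_positivity (R : realType) (x y : Z2) :
  Z2_dist R x y = 0 -> x = y.
Proof. by move/Z2_norm_eq0/eqP; rewrite subr_eq0 => /eqP. Qed.

Lemma Z2_ballE (R : realType) (x : Z2) (e : R) :
  ball x e = [set y | Z2_dist R x y < e].
Proof. by []. Qed.

HB.instance Definition _ (R : realType) := @PseudoMetric_isMetric.Build R Z2
  (@Z2_dist R) (@Z2_dist_ge0 R) (@Z2_dist_positivity R) (@Z2_ballE R).

Fixpoint fibonacci_poly (A : nzRingType) (m : nat) : {poly A} :=
  match m with
  | 0 => 0
  | m'.+1 => match m' with
             | 0 => 1
             | m''.+1 => 'X * fibonacci_poly A m' + fibonacci_poly A m''
             end
  end.

Definition periodic_points (T : Type) (f : T -> T) : set T :=
  [set x | exists2 n, (0 < n)%N & iter n f x = x].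

Definition forward_orbit (T : Type) (f : T -> T) (x : T) : set T :=
  range (fun n => iter n f x).

Definition attracting_basin (R : realType) (T : metricType R) (f : T -> T)
    (C : set T) : set T :=
  [set x | edist_inf C (iter n f x) @[n --> \oo] --> 0%E].

Definition finite_union_of_balls (R : realType) (T : metricType R)
    (C : set T) : Prop :=
  exists S : set (T * R), [/\ finite_set S, (forall p, S p -> 0 < p.2)
    & C = \bigcup_(p in S) ball p.1 p.2].

Record minimal_component (R : realType) (T : metricType R) (f : T -> T)
    (C : set T) : Prop := MinimalComponent {
  component_nonempty : C !=set0 ;
  component_clopen : clopen C ;
  component_balls : finite_union_of_balls C ;
  component_invariant : f @` C `<=` C ;
  component_minimal : forall x, C x -> C `<=` closure (forward_orbit f x)
}.

(* The components M_i are indexed by a set D of natural numbers, which accounts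
   for the family being at most countable. *)
Record minimal_decomposition (R : realType) (T : metricType R) (f : T -> T)
    (P : set T) (D : set nat) (M : nat -> set T) (B : set T) : Prop :=
    MinimalDecomposition {
  decomposition_cover : [set: T] = P `|` \bigcup_(i in D) M i `|` B ;
  decomposition_PM : P `&` \bigcup_(i in D) M i = set0 ;
  decomposition_PB : P `&` B = set0 ;
  decomposition_MB : \bigcup_(i in D) M i `&` B = set0 ;
  decomposition_trivIset : trivIset D M ;
  periodic_finite : finite_set P ;
  periodicE : P = periodic_points f ;
  componentsE : forall C, minimal_component f C <-> exists2 i, D i & C = M i ;
  basin_attracted : forall x, B x ->
    (exists2 y, periodic_points f y & attracting_basin f (forward_orbit f y) x)
    \/ (exists2 i, D i & attracting_basin f (M i) x)
}.

(* The ball a + 2^n Z_2. *)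
Definition Z2_coset (a : Z2) (n : nat) : set Z2 :=
  [set a + 2 ^+ n * z | z in [set: Z2]].

(* Main.v *)
Require Import Defs.
From mathcomp Require Import all_boot all_order all_algebra.
From mathcomp Require Import all_classical all_reals all_analysis.
From mathcomp Require Import ring zify.

Import Order.TTheory GRing.Theory Num.Theory.
Import numFieldNormedType.Exports.

Local Open Scope classical_set_scope.
Local Open Scope ring_scope.

(** Write [f] for the Fibonacci polynomial of index [4 + 48 d].  The odd and the
even 2-adic integers are both stable under [f], and are treated separately.

Even points.  An even-index Fibonacci polynomial is [k x] modulo [x^2], with
[2 k] the index; here [k] is even, so [f] maps an even [x] to a multiple of
[2 x].  Hence the even points converge to [0], and none but [0] is periodic.

Odd points, arithmetic.  The pair [(F_n, F_{n+1})] at [x] is driven by the matrix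
[[x, 1; 1, 0]].  The square of an odd [x] is [1] modulo [8], and repeated doubling
from index [6] shows that the 48th power of this matrix is the scalar [33] modulo
[64] ([fibonacci48]).  So modulo [64], at odd points, [f] is the unit
[e = 1 + 32 d] times [F_4 = x^3 + 2 x]; as [e^2 = 1] modulo [64] and [F_4] is an
odd function, the two units cancel in [f \o f], and a computation with
[F_4 \o F_4] gives [f (f x) = x + 32] modulo [64] ([fib_twice]).  The same
congruence determines the derivative of [f] modulo [4] at odd points: it is [1]
([fib_increment]).

Odd points, dynamics.  A map [g] that adds [2^k * odd] to each point and
multiplies differences by [1 + 4 c] behaves like the translation by [2^k]: its
[n]-th iterate adds [2^(k + v) * odd], where [v] is the 2-adic valuation of [n]
([odometer_iter_valuation]).  Applied to [g = f \o f] and [k = 5], this excludes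
odd periodic points, and shows that the [g]-orbit of [x] is dense in the ball
[x + 32 Z_2].  Since [f] exchanges the balls [1 + 4 k + 32 Z_2] and
[3 + 4 k + 32 Z_2], it is minimal on their union.

There is no other minimal component: a component with an odd point meets one of
these eight unions and then equals it, and a component with an even point
contains [0], hence is reduced to the fixed point, which is not open. *)

(** * Fibonacci polynomials in a commutative ring *)

Section Fib.
Context {A : comNzRingType}.
Implicit Types (x t : A) (n k d : nat).
Local Notation F n x := (fibonacci_poly _ n).[x].

Lemma fibonacciSS n x : F n.+2 x = x * F n.+1 x + F n x.
Proof. by rewrite [fibonacci_poly A n.+2]/= hornerD hornerM hornerX. Qed.

Lemma fibonacci0 x : F 0 x = 0. Proof. exact: horner0. Qed.
Lemma fibonacci1 x : F 1 x = 1. Proof. exact: hornerC. Qed.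

Definition fibonacciE := (fibonacciSS, fibonacci1, fibonacci0).

Lemma fibonacciD n k x :
  F (n + k).+1 x = F n.+1 x * F k.+1 x + F n x * F k x.
Proof.
elim: k n => [|k IH] n.
  by rewrite addn0 fibonacci1 fibonacci0; ring.
by rewrite addnS -addSn IH !fibonacciSS; ring.
Qed.

Lemma fibonacci_double n x :
  F (n + n) x = F n x * (2 * F n.+1 x - x * F n x).
Proof.
case: n => [|n]; first by rewrite addn0 fibonacci0; ring.
by rewrite addSn fibonacciD fibonacciSS; ring.
Qed.

(** Modulo [64], the 48th power of the matrix [[x, 1; 1, 0]] is the scalar [33].
At index [6] the off-diagonal entry is divisible by [8], and each doubling of the
index gains one more factor of two: [8, 16, 32, 64].  The diagonal entries are
squared modulo [64] meanwhile; their dependence on [x], through [b], is killed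
along the way. *)
Lemma fibonacci48 x t : x ^+ 2 = 1 + 8 * t ->
  exists a b, F 48 x = 64 * a /\ F 49 x = 33 + 64 * b.
Proof.
move=> xt.
pose a := x * (1 + 4 * t) * (1 + 2 * t).
pose b := 1 + 19 * t + 64 * t ^+ 2 + 64 * t ^+ 3.
have F6 : F 6 x = 8 * a.
  transitivity (x * (x ^+ 2 + 1) * (x ^+ 2 + 3)).
    by rewrite !fibonacciE; ring.
  by rewrite xt /a; ring.
have F7 : F 7 x = 5 + 8 * b.
  transitivity ((x ^+ 2) ^+ 3 + 5 * (x ^+ 2) ^+ 2 + 6 * x ^+ 2 + 1).
    by rewrite !fibonacciE; ring.
  by rewrite xt /b; ring.
pose a1 := a * (5 + 8 * b - 4 * x * a).
have F12 : F 12 x = 16 * a1 by rewrite (fibonacci_double 6) F6 F7 /a1; ring.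
pose b1 := b + b ^+ 2 + a ^+ 2.
have F13 : F 13 x = 25 + 16 * b + 64 * b1.
  by rewrite (fibonacciD 6 6) F6 F7 /b1; ring.
pose a2 := a1 * (25 + 16 * b + 64 * b1 - 8 * x * a1).
have F24 : F 24 x = 32 * a2 by rewrite (fibonacci_double 12) F12 F13 /a2; ring.
have [b2 F25] : exists b2, F 25 x = 49 + 32 * b + 64 * b2.
  exists (9 + 12 * b + 50 * b1 + 4 * b ^+ 2 + 32 * b * b1 + 64 * b1 ^+ 2
           + 4 * a1 ^+ 2).
  by rewrite (fibonacciD 12 12) F12 F13; ring.
exists (a2 * (49 + 32 * b + 64 * b2 - 16 * x * a2)).
exists (37 + 49 * b + 98 * b2 + 16 * b ^+ 2 + 64 * b * b2 + 64 * b2 ^+ 2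
        + 16 * a2 ^+ 2).
split.
  by rewrite (fibonacci_double 24) F24 F25; ring.
by rewrite (fibonacciD 24 24) F24 F25; ring.
Qed.

(** Powers of the scalar [33] are [33 ^ d = 1 + 32 d] modulo [64]. *)
Lemma fibonacci48M x t d : x ^+ 2 = 1 + 8 * t ->
  exists a b, F (48 * d) x = 64 * a /\ F (48 * d).+1 x = 1 + 32 * d%:R + 64 * b.
Proof.
move=> xt; have [a0 [b0 [F48 F49]]] := fibonacci48 x t xt.
elim: d => [|d [a [b [IHa IHb]]]].
  by exists 0, 0; rewrite muln0 fibonacci0 fibonacci1; split; ring.
have F47 : F 47 x = 33 + 64 * (b0 - x * a0).
  have := fibonacciSS 47 x.
  rewrite F48 F49 => /esym/(canRL (addKr _)) ->; ring.
rewrite mulnS addnC -natr1.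
exists (a * (33 + 64 * (b0 - x * a0)) + (1 + 32 * d%:R + 64 * b) * a0).
exists (16 * d%:R + 33 * b + b0 + 32 * d%:R * b0 + 64 * b * b0
        + 64 * a * a0).
split; last by rewrite fibonacciD F48 F49 IHa IHb; ring.
rewrite addnS (fibonacciD (48 * d) 47) F47 F48 IHa IHb; ring.
Qed.

Lemma fibonacci4 x : F 4 x = x ^+ 3 + 2 * x.
Proof. by rewrite !fibonacciE; ring. Qed.

Lemma fibonacci_mod64 x t d : x ^+ 2 = 1 + 8 * t ->
  exists c, F (4 + 48 * d) x = (1 + 32 * d%:R) * (x ^+ 3 + 2 * x) + 64 * c.
Proof.
move=> xt; have [a [b [Fa Fb]]] := fibonacci48M x t d xt.
rewrite addnC addnS fibonacciD Fa Fb fibonacci4.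
by exists (b * (x ^+ 3 + 2 * x) + a * F 3 x); ring.
Qed.

(** The recurrence mixes the two parities of the index, so that both expansions
at [0] have to be followed together. *)
Lemma fibonacci_mod_sqr k x :
  exists c e, F (k + k) x = x * (k%:R + x * c) /\ F (k + k).+1 x = 1 + x * e.
Proof.
elim: k => [|k [c [e [IHc IHe]]]].
  by exists 0, 0; rewrite fibonacci0 fibonacci1; split; ring.
exists (c + e).
exists (k.+1%:R * x + x ^+ 2 * c + x ^+ 2 * e + e).
rewrite addSn addnS -natr1.
rewrite !(fibonacciSS (k + k).+1) !(fibonacciSS (k + k)) IHc IHe.
by split; ring.
Qed.

(** The quantifiers matter: [D], the derivative at [x], does not depend on [h], so
that it can be computed from one increment and used for all others. *)
Lemma horner_taylor2 (p : {poly A}) x :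
  exists D, forall h, exists c, p.[x + h] = p.[x] + h * D + h ^+ 2 * c.
Proof.
elim/poly_ind: p => [|p a [D IH]].
  by exists 0 => h; exists 0; rewrite !horner0; ring.
exists (p.[x] + x * D) => h; have [c E] := IH h.
by exists (D + (x + h) * c); rewrite !hornerMXaddC E; ring.
Qed.

End Fib.

(** * Divisibility by powers of two and topology of the 2-adic integers *)

Lemma res2_natr k n : (k%:R : Z2) n = (k%:Z %% 2 ^+ n)%Z.
Proof.
elim: k => [|k IH]; first by rewrite res2_0 mod0z.
by rewrite -natr1 res2D IH /= modzDm intS addrC.
Qed.

Lemma res2_modn (z : Z2) k n : (z (n + k)%N %% 2 ^+ n)%Z = z n.
Proof.
elim: k => [|k IH]; first by rewrite addn0 res2_mod.
rewrite -IH addnS [in RHS]res2_coherent.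
rewrite {1}(divz_eq (z (n + k).+1) (2 ^+ (n + k))) exprD mulrCA mulrC.
by rewrite modzMDl.
Qed.

(** Multiplication by [2^k] shifts the sequence of residues by [k], whence its
injectivity. *)
Lemma res2_exp2M (z : Z2) k n :
  ((2 ^+ k * z) (n + k)%N == 0) = (z n == 0).
Proof.
rewrite res2M -natrX res2_natr modzMml -natz natrX exprD mulrC.
apply/eqP/eqP => [/dvdz_mod0P|zn]; last apply/dvdz_mod0P.
  by rewrite dvdz_mul2r ?expf_neq0// => /dvdz_mod0P; rewrite res2_modn.
by rewrite dvdz_mul2r ?expf_neq0//; apply/dvdz_mod0P; rewrite res2_modn.
Qed.

Lemma res2_exp2M_le (z : Z2) k n : (n <= k)%N -> (2 ^+ k * z) n = 0.
Proof.
move=> nk; apply: etrans (res2_0 n); apply: (res2_le nk).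
by rewrite res2_0; apply/eqP; rewrite (res2_exp2M _ _ 0) res2_coherent modz1.
Qed.

Lemma Z2_exp2_mulI k : injective (fun z : Z2 => 2 ^+ k * z).
Proof.
move=> x y /eqP; rewrite -subr_eq0 -mulrBr => /eqP xy0; apply/eqP.
rewrite -subr_eq0; apply/eqP/Z2_ext => n; rewrite res2_0.
by apply/eqP; rewrite -(res2_exp2M _ k) xy0 res2_0.
Qed.

Lemma Z2_divE (x : Z2) n : x n = 0 -> exists z, x = 2 ^+ n * z.
Proof.
move=> xn; have n0 : (2 ^+ n : int) != 0 by rewrite expf_neq0.
have div k : (x (k + n)%N %/ 2 ^+ n)%Z * 2 ^+ n = x (k + n)%N.
  by rewrite divzK//; apply/dvdz_mod0P; rewrite addnC res2_modn xn.
have coh k : ((x (k.+1 + n)%N %/ 2 ^+ n)%Z %% 2 ^+ k)%Z =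
             ((x (k + n)%N %/ 2 ^+ n)%Z %% 2 ^+ k)%Z.
  apply: (mulIf n0); rewrite ![_ * 2 ^+ n]mulrC !mulz_modr ?exprn_gt0//.
  rewrite ![2 ^+ n * (_ %/ _)%Z]mulrC !div -exprD (addnC n) addSn.
  by rewrite -res2_coherent res2_mod.
exists (Z2_of (u := fun k => (x (k + n)%N %/ 2 ^+ n)%Z) coh).
apply: Z2_ext => k; rewrite res2M -natrX res2_natr modzMml -natz natrX /=.
by rewrite modzMmr mulrC div res2_modn.
Qed.

Lemma Z2_cosetE a n (x : Z2) : Z2_coset a n x <-> x n = a n.
Proof.
split=> [[z _ <-]|xa].
  by apply/eqP; rewrite -res2B_eq0 addrAC subrr add0r res2_exp2M_le.
have /Z2_divE[z E] : (x - a) n = 0 by apply/eqP; rewrite res2B_eq0 xa.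
by exists z => //; rewrite -E addrC subrK.
Qed.

Lemma Z2_nbhsP (x : Z2) (A : set Z2) :
  nbhs x A <-> exists n, Z2_coset x n `<=` A.
Proof.
split=> [/nbhsP[E [n _ nE] EA]|[n nA]].
  by exists n => y /Z2_cosetE xy; apply: EA; apply/xsectionP; apply: nE.
apply/nbhsP; exists [set xy : Z2 * Z2 | xy.1 n = xy.2 n]; first by exists n.
by move=> y /xsectionP /= xy; apply: nA; apply/Z2_cosetE.
Qed.

Lemma Z2_closureP (A : set Z2) x :
  closure A x <-> forall n, exists2 y, A y & y n = x n.
Proof.
split=> [cA n|cA B /Z2_nbhsP[n nB]].
  have [|y [Ay /Z2_cosetE yx]] := cA (Z2_coset x n); last by exists y.
  by apply/Z2_nbhsP; exists n.
by have [y Ay yx] := cA n; exists y; split=> //; apply/nB/Z2_cosetE.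
Qed.

Lemma Z2_clopen (A : set Z2) n :
  (forall x y : Z2, A x -> x n = y n -> A y) -> clopen A.
Proof.
move=> An; split.
  rewrite openE => x Ax; apply/Z2_nbhsP; exists n => y /Z2_cosetE yx.
  exact: An Ax (esym yx).
by move=> x /Z2_closureP/(_ n)[y Ay yx]; exact: An Ay yx.
Qed.

Lemma Z2_cvg_seq (u : nat -> Z2) (l : Z2) :
  (forall n, \forall k \near \oo, u k n = l n) -> u k @[k --> \oo] --> l.
Proof.
move=> ul A /Z2_nbhsP[n nA]; near=> k; apply/nA/Z2_cosetE.
by near: k; exact: ul.
Unshelve. all: by end_near. Qed.

(** The distance to [C] is continuous and vanishes on [C]. *)
Lemma cvg_attracting_basin (R : realType) (f : Z2 -> Z2) (C : set Z2) x y :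
  C y -> iter n f x @[n --> \oo] --> y -> @attracting_basin R Z2 f C x.
Proof.
move=> Cy cvy; rewrite /attracting_basin /= -(edist_inf0 Cy).
exact: cvg_comp cvy (@edist_inf_continuous R Z2 C y).
Qed.

Lemma Z2_coset_ball (R : realType) (a : Z2) n :
  @ball R Z2 a (2 ^- n) = Z2_coset a n.+1.
Proof.
apply/seteqP; split => x; rewrite Z2_ballE /= /Z2_dist Z2_norm_lt res2B_eq0.
  by move/eqP => xa; apply/Z2_cosetE.
by move/Z2_cosetE => ->.
Qed.

(** * Parity and odometers *)

Definition Z2_odd : set Z2 := range (fun y : Z2 => 1 + 2 * y).

Lemma Z2_oddE (x : Z2) : Z2_odd x <-> x 1%N = 1.
Proof.
split=> [[y _ <-]|x1].
  by rewrite res2D (res2_exp2M_le y 1 1).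
have [|y E] := Z2_divE (x - 1) 1; first by apply/eqP; rewrite res2B_eq0 x1.
by exists y => //; rewrite -[2]expr1 -E addrC subrK.
Qed.

Lemma Z2_evenE (x : Z2) : (exists y, x = 2 * y) <-> x 1%N = 0.
Proof.
split=> [[y ->]|/Z2_divE//]; exact: (res2_exp2M_le y 1 1).
Qed.

Lemma Z2_parity (x : Z2) : (exists y, x = 2 * y) \/ Z2_odd x.
Proof.
have := res2_mod x 1; rewrite expr1 => x2.
have [x0|x1] : x 1%N = 0 \/ x 1%N = 1 by lia.
  by left; apply/Z2_evenE.
by right; apply/Z2_oddE.
Qed.

Lemma Z2_odd_neq0 (x : Z2) : Z2_odd x -> x <> 0.
Proof. by move=> /Z2_oddE x1 x0; move: x1; rewrite x0 res2_0. Qed.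

Lemma Z2_oddD (x y : Z2) : Z2_odd x -> Z2_odd (x + 2 * y).
Proof. by move=> [z _ <-]; exists (z + y) => //; ring. Qed.

Lemma Z2_mulS_even (j : Z2) : exists e, j * (j + 1) = 2 * e.
Proof.
have [[y ->]|[y _ <-]] := Z2_parity j.
  by exists (y * (2 * y + 1)); ring.
by exists ((1 + 2 * y) * (1 + y)); ring.
Qed.

Lemma Z2_odd_sqr (x : Z2) : Z2_odd x -> exists t, x ^+ 2 = 1 + 8 * t.
Proof.
move=> [y _ <-]; have [e E] := Z2_mulS_even y; exists e.
transitivity (1 + 4 * (y * (y + 1))); first ring.
by rewrite E; ring.
Qed.

(** The hypotheses [g_step] and [g_increment] say that [g] is a perturbation of
the translation by [2^k]: all its displacements have valuation exactly [k], and
differences are preserved up to a factor [1] modulo [4]. *)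
Section Odometer.
Variables (A : set Z2) (k : nat) (g : Z2 -> Z2).
Hypothesis A_coset : forall x h, A x -> A (x + 2 ^+ k * h).
Hypothesis g_step : forall x, A x -> exists u, g x = x + 2 ^+ k * (1 + 2 * u).
Hypothesis g_increment : forall x h, A x ->
  exists c, g (x + 2 ^+ k * h) = g x + 2 ^+ k * (h * (1 + 4 * c)).

(** A sum of [n] odd multiples of [2^k] is [2^k] times a number of the parity of
[n]. *)
Lemma odometer_iter n x : A x ->
  exists w, iter n g x = x + 2 ^+ k * (n%:R + 2 * w).
Proof.
move=> Ax; elim: n => [|n [w IH]] /=; first by exists 0; ring.
have [|u ->] := g_step (iter n g x); first by rewrite IH; exact: A_coset.
by rewrite IH; exists (w + u); rewrite -natr1; ring.
Qed.

Lemma odometer_iter_stable n x : A x -> A (iter n g x).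
Proof. by move=> /[dup] Ax /(odometer_iter n)[w ->]; exact: A_coset. Qed.

Lemma odometer_iter_increment n x h : A x ->
  exists c, iter n g (x + 2 ^+ k * h) = iter n g x + 2 ^+ k * (h * (1 + 4 * c)).
Proof.
move=> Ax; elim: n => [|n [c IH]] /=; first by exists 0; ring.
have [b gE] := g_increment _ (h * (1 + 4 * c)) (odometer_iter_stable n x Ax).
rewrite IH gE.
by exists (c + b + 4 * c * b); ring.
Qed.

(** For odd [n], displacements in [2^k * odd] add up to one of the same kind.  For
even [n], the [n/2]-th iterate is used twice: its two successive
displacements agree up to a factor [1 + 4 c], so they add up to the first one
times [2 + 4 c], which gains exactly one factor of two. *)
Lemma odometer_iter_valuation n x : (0 < n)%N -> A x ->
  exists u, iter n g x = x + 2 ^+ (k + logn 2 n) * (1 + 2 * u).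
Proof.
move=> + Ax; elim/ltn_ind: n => n IH n0.
have [on|en] := boolP (odd n).
  have [w ->] := odometer_iter n x Ax.
  have -> : logn 2 n = 0%N by rewrite logn_coprime// coprime2n.
  have -> : n%:R = 1 + 2 * n./2%:R :> Z2.
    by rewrite -{1}[n]odd_double_half on -muln2 natrD natrM mulrC.
  by exists (n./2%:R + w); rewrite addn0; ring.
have nE := odd_double_half n; rewrite (negbTE en) add0n in nE.
have m0 : (0 < n./2)%N by lia.
have [|u E] := IH n./2 _ m0; first lia.
have [c] := odometer_iter_increment n./2 x (2 ^+ logn 2 n./2 * (1 + 2 * u)) Ax.
rewrite mulrA -exprD -E -iterD addnn nE => ->.
have -> : logn 2 n = (logn 2 n./2).+1.
  by rewrite -[in LHS]nE -muln2 lognM// addn1.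
rewrite E addnS exprS exprD; exists (u + c + 2 * u * c); ring.
Qed.

Lemma odometer_aperiodic n x : (0 < n)%N -> A x -> iter n g x <> x.
Proof.
move=> n0 Ax; have [u ->] := odometer_iter_valuation n x n0 Ax => E.
apply: (Z2_odd_neq0 (1 + 2 * u)); first by exists u.
apply: (Z2_exp2_mulI (k + logn 2 n)) => /=; rewrite mulr0.
by apply: (addrI x); rewrite E addr0.
Qed.

(** Successive approximation: when the error at precision [k + n] is an odd
multiple of [2^(k + n)], [2^n] further iterations add another odd multiple of
[2^(k + n)], and the error becomes divisible by [2^(k + n + 1)]. *)
Lemma odometer_dense n x h : A x ->
  exists j e, x + 2 ^+ k * h = iter j g x + 2 ^+ (k + n) * e.
Proof.
move=> Ax; elim: n => [|n [j [e IH]]]; first by exists 0%N, h; rewrite addn0.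
(* [e] is even: the precision has improved by itself; [e] is odd: iterate. *)
rewrite IH; have [[e' ->]|[e' _ <-]] := Z2_parity e.
  by exists j, e'; rewrite addnS exprS; ring.
have [|u E] := odometer_iter_valuation (2 ^ n) (iter j g x) _
  (odometer_iter_stable j x Ax); first by rewrite expn_gt0.
exists (2 ^ n + j)%N, (e' - u).
by rewrite iterD E pfactorK// addnS exprS; ring.
Qed.

End Odometer.

(** * The polynomial of index 4 + 48 d *)

Section FibonacciMap.
Variable d : nat.
Let f (x : Z2) := (fibonacci_poly Z2 (4 + 48 * d)).[x].

Lemma fib_mod64 x t : x ^+ 2 = 1 + 8 * t ->
  exists c, f x = (1 + 32 * d%:R) * (x ^+ 3 + 2 * x) + 64 * c.
Proof. exact: fibonacci_mod64. Qed.

Lemma fib_odd x : Z2_odd x -> Z2_odd (f x).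
Proof.
move=> xo; have [t xt] := Z2_odd_sqr x xo.
have [c ->] := fib_mod64 x t xt.
have -> : (1 + 32 * d%:R) * (x ^+ 3 + 2 * x) + 64 * c
  = x + 2 * (x + 4 * t * x + 16 * d%:R * (x ^+ 3 + 2 * x) + 32 * c).
  by rewrite exprS xt; ring.
exact: Z2_oddD.
Qed.

(** The derivative [D] of [f] at an odd point is [1] modulo [4].  Since
[f (x + 4) - f x = 4 D] modulo [16], it suffices to know [f] modulo [16] at odd
points, where it is [F_4]; dividing by [4] is legitimate as [Z_2] has no
torsion. *)
Lemma fib_increment x h : Z2_odd x ->
  exists c, f (x + 4 * h) = f x + 4 * (h * (1 + 4 * c)).
Proof.
move=> xo; have [t xt] := Z2_odd_sqr x xo.
have [D taylor] := horner_taylor2 (fibonacci_poly Z2 (4 + 48 * d)) x.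
suff [c0 DE] : exists c0, D = 1 + 4 * c0.
  have [c] := taylor (4 * h); rewrite -!/(f _) => ->.
  by exists (c0 + h * c); rewrite DE; ring.
have [c1 E1] := fibonacci_mod64 x t d xt.
have x4t : (x + 4) ^+ 2 = 1 + 8 * (t + x + 2).
  by rewrite sqrrD xt; ring.
have [c2 E2] := fibonacci_mod64 (x + 4) _ d x4t.
have [c] := taylor 4; rewrite E1 E2 => E.
exists (5 + 6 * t + 3 * x + 8 * d%:R * (21 + 24 * t + 12 * x)
        + 4 * (c2 - c1) - c).
apply: (Z2_exp2_mulI 2) => /=.
transitivity ((1 + 32 * d%:R) * ((x + 4) ^+ 3 + 2 * (x + 4)) + 64 * c2
  - (1 + 32 * d%:R) * (x ^+ 3 + 2 * x) - 64 * c1 - 16 * c).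
  by rewrite E; ring.
transitivity ((1 + 32 * d%:R) * (12 * x ^+ 2 + 48 * x + 72)
  + 64 * (c2 - c1) - 16 * c); first ring.
by rewrite xt; ring.
Qed.

(** Modulo [32], [f] is [F_4], and [F_4 (1 + 4 j)] exceeds [3 + 4 j] by a multiple
of [16] whose cofactor is even because [j (j + 1)] is; likewise for
[F_4 (3 + 4 j)] and [1 + 4 j]. *)
Lemma fib_swap1 (j : Z2) : exists c, f (1 + 4 * j) = 3 + 4 * j + 32 * c.
Proof.
have [e E] := Z2_mulS_even j.
have xt : (1 + 4 * j) ^+ 2 = 1 + 8 * (j + 2 * j ^+ 2) by ring.
have [c ->] := fib_mod64 _ _ xt.
exists (e + j ^+ 2 + 2 * j ^+ 3
  + d%:R * ((1 + 4 * j) ^+ 3 + 2 * (1 + 4 * j)) + 2 * c).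
transitivity (3 + 4 * j + 16 * (j * (j + 1)) + 32 * j ^+ 2 + 64 * j ^+ 3
  + 32 * d%:R * ((1 + 4 * j) ^+ 3 + 2 * (1 + 4 * j)) + 64 * c); first ring.
by rewrite E; ring.
Qed.

Lemma fib_swap3 (j : Z2) : exists c, f (3 + 4 * j) = 1 + 4 * j + 32 * c.
Proof.
have [e E] := Z2_mulS_even j.
have xt : (3 + 4 * j) ^+ 2 = 1 + 8 * (1 + 3 * j + 2 * j ^+ 2) by ring.
have [c ->] := fib_mod64 _ _ xt.
exists (1 + 7 * e + j ^+ 2 + 2 * j ^+ 3
  + d%:R * ((3 + 4 * j) ^+ 3 + 2 * (3 + 4 * j)) + 2 * c).
transitivity (33 + 4 * j + 16 * 7 * (j * (j + 1)) + 32 * j ^+ 2 + 64 * j ^+ 3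
  + 32 * d%:R * ((3 + 4 * j) ^+ 3 + 2 * (3 + 4 * j)) + 64 * c); first ring.
by rewrite E; ring.
Qed.

(** Modulo [64], [f] is [e F_4] with [e^2 = 1], and [F_4 (e y) = e F_4 y], hence
[f (f x) = F_4 (F_4 x)].  With [x^2 = 1 + 8 t], the latter is [33 x] modulo
[64], and [33 x = x + 32] because [x] is odd. *)
Lemma fib_twice x : Z2_odd x ->
  exists u, f (f x) = x + 2 ^+ 5 * (1 + 2 * u).
Proof.
move=> xo; have [t xt] := Z2_odd_sqr x xo.
have [t1 fxt] := Z2_odd_sqr (f x) (fib_odd x xo).
have [c fx] := fib_mod64 x t xt; have [c1 ->] := fib_mod64 (f x) t1 fxt.
set e := 1 + 32 * d%:R in fx *; set y := x ^+ 3 + 2 * x in fx.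
pose w := d%:R + 16 * d%:R ^+ 2 : Z2.
have e2 : e ^+ 2 = 1 + 64 * w by rewrite /e /w; ring.
have yt : y = x * (3 + 8 * t) by rewrite /y exprS xt; ring.
have y2 : y ^+ 2 = 9 + 120 * t + 448 * t ^+ 2 + 512 * t ^+ 3.
  by rewrite yt exprMn xt; ring.
pose s := 7 * t + 36 * t ^+ 2 + 80 * t ^+ 3 + 64 * t ^+ 4.
have yy : y * (y ^+ 2 + 2) = x * (33 + 64 * s).
  by rewrite y2 yt /s; ring.
pose v := c * (3 * e ^+ 2 * y ^+ 2 + 192 * e * y * c + 4096 * c ^+ 2 + 2).
pose r := w * y * (e ^+ 2 * y ^+ 2 + 2) + w * y ^+ 3 + e * v + c1.
have [z _ zE] := xo.
exists (z + x * s + r).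
transitivity (y * (y ^+ 2 + 2) + 64 * r).
  transitivity (e ^+ 2 * (y * (e ^+ 2 * y ^+ 2 + 2)) + 64 * (e * v + c1)).
    by rewrite fx /v; ring.
  by rewrite /r e2; ring.
transitivity (x + 32 * x + 64 * (x * s + r)); first by rewrite yy; ring.
by rewrite -{2}zE; ring.
Qed.

Lemma fib_twice_increment x h : Z2_odd x ->
  exists c, f (f (x + 2 ^+ 5 * h)) = f (f x) + 2 ^+ 5 * (h * (1 + 4 * c)).
Proof.
move=> xo; have [c E] := fib_increment x (8 * h) xo.
have [c' E'] := fib_increment (f x) (8 * h * (1 + 4 * c)) (fib_odd x xo).
have -> : x + 2 ^+ 5 * h = x + 4 * (8 * h) by ring.
by rewrite E E'; exists (c + c' + 4 * c * c'); ring.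
Qed.

(** Modulo [x^2], [f] is [(2 + 24 d) x], with an even coefficient. *)
Lemma fib_even y : exists c, f (2 * y) = 2 * (2 * y) * c.
Proof.
have [c [e [E _]]] := fibonacci_mod_sqr (2 + 24 * d) (2 * y).
rewrite /f (_ : (4 + 48 * d)%N = (2 + 24 * d + (2 + 24 * d))%N); last by lia.
rewrite E; exists (1 + 12 * d%:R + y * c).
by rewrite natrD natrM; ring.
Qed.

Lemma fib_even_iter y n : exists c, iter n f (2 * y) = 2 ^+ n * (2 * y * c).
Proof.
elim: n => [|n [c IH]] /=; first by exists 1; ring.
have [b E] := fib_even (2 ^+ n * (y * c)).
rewrite IH; have -> : 2 ^+ n * (2 * y * c) = 2 * (2 ^+ n * (y * c)) by ring.
by rewrite E; exists (c * b); rewrite exprS; ring.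
Qed.

Lemma fib0 : f 0 = 0.
Proof. by have [c] := fib_even 0; rewrite !mulr0 mul0r. Qed.

Lemma iter_twice n x : iter n (f \o f) x = iter (n * 2) f x.
Proof. by rewrite iterM; apply: eq_iter. Qed.

Lemma Z2_odd_coset32 x h : Z2_odd x -> Z2_odd (x + 2 ^+ 5 * h).
Proof.
move=> xo; have -> : x + 2 ^+ 5 * h = x + 2 * (16 * h) by ring.
exact: Z2_oddD.
Qed.

Lemma fib_odd_aperiodic n x : (0 < n)%N -> Z2_odd x -> iter n f x <> x.
Proof.
move=> n0 xo fx.
have := odometer_aperiodic _ _ _
  Z2_odd_coset32 fib_twice fib_twice_increment n x n0 xo.
apply.
by rewrite iter_twice mulnC mul2n -addnn iterD !fx.
Qed.

Lemma fib_odd_dense x h n : Z2_odd x ->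
  exists j, iter j f x n = (x + 2 ^+ 5 * h) n.
Proof.
move=> xo; have [j [e E]] :=
  odometer_dense _ _ _ Z2_odd_coset32 fib_twice fib_twice_increment n x h xo.
exists (j * 2)%N; rewrite -iter_twice; apply/eqP; rewrite -res2B_eq0.
rewrite [X in _ - X]E opprD addrA subrr add0r -mulrN.
by rewrite res2_exp2M_le// leq_addl.
Qed.

Lemma fib_periodic : periodic_points f = [set 0].
Proof.
apply/seteqP; split=> x; last first.
  by move=> ->; exists 1%N => //=; exact: fib0.
move=> [n n0 fx]; have [[y xE]|xo] := Z2_parity x; last first.
  by have := fib_odd_aperiodic n x n0 xo fx.
apply: Z2_ext => k; rewrite res2_0.
(* An even periodic point is divisible by arbitrarily large powers of two. *)
have : iter (k * n) f x = x by rewrite iterM iter_fix.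
rewrite {1}xE; have [c ->] := fib_even_iter y (k * n) => <-.
by rewrite res2_exp2M_le// leq_pmulr.
Qed.

Lemma fib_even_cvg y : iter n f (2 * y) @[n --> \oo] --> (0 : Z2).
Proof.
apply: Z2_cvg_seq => n; near=> k.
have [c ->] := fib_even_iter y k.
rewrite res2_0 res2_exp2M_le//; near: k; exact: nbhs_infty_ge.
Unshelve. all: by end_near. Qed.

End FibonacciMap.

(** * Minimal components *)

(** The two cosets are the balls that [f] exchanges. *)
Definition swap_pair (k : nat) : set Z2 :=
  Z2_coset (1 + 4 * k%:R) 5 `|` Z2_coset (3 + 4 * k%:R) 5.

Lemma swap_pairE k x : (k < 8)%N ->
  swap_pair k x <-> x 5%N = (1 + 4 * k)%N \/ x 5%N = (3 + 4 * k)%N.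
Proof.
move=> k8; have res a : (a < 32)%N -> (a%:R : Z2) 5%N = a.
  by move=> a32; rewrite res2_natr modz_small.
rewrite -(res (1 + 4 * k)%N); last by lia.
rewrite -(res (3 + 4 * k)%N); last by lia.
have natE a : (a + 4 * k)%:R = a%:R + 4 * k%:R :> Z2.
  by rewrite natrD natrM.
rewrite !natE.
by split=> -[] /Z2_cosetE H; [left|right|left|right].
Qed.

Lemma swap_pair_clopen k : clopen (swap_pair k).
Proof.
apply: (Z2_clopen _ 5) => x y [] /Z2_cosetE xk yx; [left|right];
  by apply/Z2_cosetE; rewrite -yx.
Qed.

Lemma swap_pair_odd k : swap_pair k `<=` Z2_odd.
Proof.
move=> x [] [z _ <-].
  by exists (2 * k%:R + 16 * z) => //; ring.
by exists (1 + 2 * k%:R + 16 * z) => //; ring.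
Qed.

Lemma swap_pair_cover x : Z2_odd x -> exists2 k, (k < 8)%N & swap_pair k x.
Proof.
move=> /Z2_oddE x1.
have x2 : (x 5%N %% 2)%Z = 1 := etrans (res2_modn x 4 1) x1.
have x32 : (x 5%N %% 32)%Z = x 5%N := res2_mod x 5.
exists (`|x 5| %/ 4)%N; first by lia.
by apply/swap_pairE; lia.
Qed.

Lemma swap_pair_disjoint k l x : (k < 8)%N -> (l < 8)%N ->
  swap_pair k x -> swap_pair l x -> k = l.
Proof. by move=> k8 l8 /swap_pairE-/(_ k8) + /swap_pairE-/(_ l8); lia. Qed.

Section Components.
Variable d : nat.
Let f (x : Z2) := (fibonacci_poly Z2 (4 + 48 * d)).[x].

Lemma fib_coset1 k x :
  Z2_coset (1 + 4 * k%:R) 5 x -> Z2_coset (3 + 4 * k%:R) 5 (f x).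
Proof.
move=> [z _ <-]; have [c E] := fib_swap1 d (k%:R + 8 * z).
have -> : 1 + 4 * k%:R + 2 ^+ 5 * z = 1 + 4 * (k%:R + 8 * z) by ring.
by rewrite /f E; exists (z + c) => //; ring.
Qed.

Lemma fib_coset3 k x :
  Z2_coset (3 + 4 * k%:R) 5 x -> Z2_coset (1 + 4 * k%:R) 5 (f x).
Proof.
move=> [z _ <-]; have [c E] := fib_swap3 d (k%:R + 8 * z).
have -> : 3 + 4 * k%:R + 2 ^+ 5 * z = 3 + 4 * (k%:R + 8 * z) by ring.
by rewrite /f E; exists (z + c) => //; ring.
Qed.

Lemma swap_pair_dense k x : swap_pair k x ->
  swap_pair k `<=` closure (forward_orbit f x).
Proof.
move=> xk y yk; apply/Z2_closureP => n.
have dense j : (iter j f x) 5%N = y 5%N ->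
    exists2 z, forward_orbit f x z & z n = y n.
  set z := iter j f x => xy.
  have zo : Z2_odd z.
    apply/Z2_oddE; rewrite (res2_le (n := 5) _ xy)//.
    by apply/Z2_oddE; exact: swap_pair_odd yk.
  have [h yE] : exists h, y - z = 2 ^+ 5 * h.
    by apply: Z2_divE; apply/eqP; rewrite res2B_eq0 xy.
  have [i] := fib_odd_dense d z h n zo.
  rewrite -yE addrC subrK -/f => E; exists (iter i f z) => //.
  by exists (i + j)%N => //; rewrite iterD.
have same a u v : Z2_coset a 5 u -> Z2_coset a 5 v -> u 5%N = v 5%N.
  by move=> /Z2_cosetE -> /Z2_cosetE ->.
(* If [x] and [y] lie in different cosets, [f x] lies in the coset of [y]. *)
case: xk => xk; case: yk => yk.
- exact: (dense 0%N) (same _ _ _ xk yk).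
- exact: (dense 1%N) (same _ _ _ (fib_coset1 k x xk) yk).
- exact: (dense 1%N) (same _ _ _ (fib_coset3 k x xk) yk).
- exact: (dense 0%N) (same _ _ _ xk yk).
Qed.

Lemma swap_pair_invariant k : f @` swap_pair k `<=` swap_pair k.
Proof.
by move=> _ [x [xk|xk] <-]; [right; exact: fib_coset1|left; exact: fib_coset3].
Qed.

Lemma swap_pair_minimal (R : realType) k :
  @minimal_component R Z2 f (swap_pair k).
Proof.
split.
- by exists (1 + 4 * k%:R); left; apply/Z2_cosetE.
- exact: swap_pair_clopen.
- exists [set (1 + 4 * k%:R, 2 ^- 4); (3 + 4 * k%:R, 2 ^- 4)]; split.
  + exact: finite_set2.
  + by move=> p [] -> /=; rewrite invr_gt0 exprn_gt0.
  + by rewrite bigcup_setU !bigcup_set1 /= !Z2_coset_ball.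
- exact: swap_pair_invariant.
- exact: swap_pair_dense.
Qed.

Lemma invariant_closure_orbit (C : set Z2) x :
  closed C -> f @` C `<=` C -> C x -> closure (forward_orbit f x) `<=` C.
Proof.
move=> cC fC Cx; rewrite [X in _ `<=` X](closure_id _).1//.
apply: closureS => _ [n _ <-]; elim: n => //= n IH.
by apply: fC; exists (iter n f x).
Qed.

(** Two closed invariant sets on both of which the orbit of a common point is
dense are equal, which settles components with an odd point.  A component with an
even point contains the limit [0] of its orbit; the orbit of [0] being trivial,
the component is [{0}], which is not open since it does not contain [2^n]. *)
Lemma minimal_component_swap_pair (R : realType) (C : set Z2) :
  @minimal_component R Z2 f C -> exists2 k, (k < 8)%N & C = swap_pair k.
Proof.
move=> [[x Cx] [oC cC] _ fC mC].
have [[y xE]|/swap_pair_cover[k k8 xk]] := Z2_parity x; last first.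
  exists k => //; apply/seteqP; split.
    apply: subset_trans (mC x Cx) _.
    apply: invariant_closure_orbit => //; last exact: swap_pair_invariant.
    by have [] := swap_pair_clopen k.
  apply: subset_trans (swap_pair_dense k x xk) _.
  exact: invariant_closure_orbit.
have C0 : C 0.
  apply: (closed_cvg _ cC _ _ (fib_even_cvg d y)); apply: nearW => n.
  rewrite -xE -/f; elim: n => //= n IH.
  by apply: fC; exists (iter n f x).
have C1 z : C z -> z = 0.
  move=> /(mC 0 C0)/Z2_closureP cz; apply: Z2_ext => n.
  have [_ [m _ <-] <-] := cz n.
  by rewrite iter_fix//; exact: fib0.
have := oC; rewrite openE => /(_ 0 C0)/Z2_nbhsP[n nC].
have /C1 : C (2 ^+ n) by apply: nC; exists 1 => //; ring.
move/eqP; rewrite -[2 ^+ n]mulr1 -[0](mulr0 (2 ^+ n : Z2)) => /eqP/Z2_exp2_mulI.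
by move/eqP; rewrite oner_eq0.
Qed.

End Components.

Theorem theorem6p5 (R : realType) (d q m : nat)
    (hq : q = (4 * d)%N) (hm : m = (4 + 12 * q)%N) :
  let f : Z2 -> Z2 := fun x => (fibonacci_poly Z2 m).[x] in
  let M : nat -> set Z2 := fun k =>
    Z2_coset (1 + 4 * k%:R) 5 `|` Z2_coset (3 + 4 * k%:R) 5 in
  let B : set Z2 := Z2_coset 0 1 `\` [set 0] in
  [/\ @minimal_decomposition R Z2 f [set 0] `I_(2 ^ 3) M B,
      f 0 = 0
    & B `<=` @attracting_basin R Z2 f [set 0]].
Proof.
move=> f M B.
have {hq} hm : m = (4 + 48 * d)%N by rewrite hm hq mulnA.
subst m.
have B_even x : B x -> exists y, x = 2 * y.
  by move=> [/Z2_cosetE x0 _]; apply/Z2_evenE; rewrite x0 res2_0.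
have M_odd : \bigcup_(i in `I_(2 ^ 3)) M i `<=` Z2_odd.
  by move=> x [k _]; exact: swap_pair_odd.
have basin C x : C 0 -> B x -> @attracting_basin R Z2 f C x.
  move=> C0 /B_even[y ->].
  by apply: cvg_attracting_basin C0 _; exact: fib_even_cvg.
split; [|exact: fib0|by move=> x; exact: basin].
split.
- apply/seteqP; split=> // x _.
  have [/Z2_evenE x0|/swap_pair_cover[k k8 xk]] := Z2_parity x; last first.
    by left; right; exists k.
  have [->|/eqP xn0] := eqVneq x 0; first by left; left.
  by right; split=> //; apply/Z2_cosetE; rewrite x0 res2_0.
- by apply/seteqP; split=> // x [-> /M_odd/Z2_odd_neq0].
- by apply/seteqP; split=> // x [-> [_ /(_ erefl)]].
- apply/seteqP; split=> // x [/M_odd/Z2_oddE x1 /B_even/Z2_evenE].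
  by rewrite x1.
- move=> k l k8 l8 [x [xk xl]]; exact: swap_pair_disjoint xk xl.
- exact: finite_set1.
- by rewrite -(fib_periodic d).
- move=> C; split=> [/minimal_component_swap_pair[k k8 ->]|[k _ ->]].
    by exists k.
  exact: swap_pair_minimal.
- move=> x Bx; left; exists 0; last by apply: basin => //; exists 0%N.
  by rewrite /periodic_points; exists 1%N => //=; exact: fib0.
Qed.
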